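(* Let $$T_n=n\int_{[0,1]^d}\Big(C_n(\mathbf{u})-\prod_{j=1}^d u_j\Big)^2\prod_{j=1}^d (u_j-0.5)^2\,d\mathbf{u}.$$ Then $$T_n=\sum_{i=1}^n\left[\frac1n\sum_{l=1}^n\prod_{j=1}^d\Big(24^{-1}-3^{-1}\big(\hat U_{i,j}\vee\hat U_{l,j}-2^{-1}\big)^3\Big)-2\prod_{j=1}^d\Big(24^{-1}-4^{-1}\hat U_{i,j}^4+3^{-1}\hat U_{i,j}^3-8^{-1}\hat U_{i,j}^2\Big)\right]+n\,30^{-d}.$$
   Context: Let $d\ge2$ and let $(X_{i,1},\dots,X_{i,d})$, $i=1,\dots,n$, be a sample of $n$ observations in $\mathbb{R}^d$. With $\mathbb{I}$ the indicator function, set $\hat F_j(x)=\frac1n\sum_{i=1}^n\mathbb{I}(X_{i,j}\le x)$, $\hat U_{i,j}=\hat F_j(X_{i,j})$, and let the empirical copula be $$C_n(\mathbf{u})=\frac1n\sum_{i=1}^n\prod_{j=1}^d\mathbb{I}(\hat U_{i,j}\le u_j),\qquad\mathbf{u}\in[0,1]^d.$$ Write $a\vee b=\max(a,b)$; in particular $\hat U_{i,j}\vee\hat U_{l,j}-2^{-1}$ means $\max(\hat U_{i,j},\hat U_{l,j})-\tfrac12$. *)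

(* Defs.v *)
From HB Require Import structures.
From mathcomp Require Import all_boot all_order all_algebra.
From mathcomp Require Import all_classical all_reals all_analysis.

Set Implicit Arguments.
Unset Strict Implicit.
Unset Printing Implicit Defensive.

Import Order.TTheory GRing.Theory Num.Theory.
Import numFieldNormedType.Exports.

Local Open Scope classical_set_scope.
Local Open Scope ring_scope.

(* Points of R^d are d-tuples, with the product of d copies of the Borel
   sigma-algebra of measurableTypeR R (a type convertible to R). The library has
   binary product measures only, so d-dimensional Lebesgue measure is built by
   recursion on d: the image of lambda^1 (x) lambda^d under (x, t) |-> x :: t.
   Lemma lebesgue_measure_tuple_box gives its value on measurable boxes. *)
Section LebesgueMeasureTuple.
Context {R : realType}.
Local Notation T := (measurableTypeR R).
Local Open Scope ereal_scope.

Definition tuple_cons n (p : (T * n.-tuple T)%type) : n.+1.-tuple T :=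
  [the n.+1.-tuple T of p.1 :: p.2].

Definition tuple_uncons n (t : n.+1.-tuple T) : (T * n.-tuple T)%type :=
  (thead t, [tuple of behead t]).

Lemma measurable_tuple_cons n : measurable_fun setT (@tuple_cons n).
Proof. exact: measurable_cons. Qed.

Lemma measurable_tuple_uncons n : measurable_fun setT (@tuple_uncons n).
Proof.
apply: (@measurable_fun_pair _ _ _ (n.+1.-tuple T) T (n.-tuple T)).
  exact: measurable_tnth.
exact: measurable_behead.
Qed.

Lemma tuple_consK n : cancel (@tuple_cons n) (@tuple_uncons n).
Proof. by case=> x t; congr (_, _); apply/val_inj. Qed.

Lemma tuple_unconsK n : cancel (@tuple_uncons n) (@tuple_cons n).
Proof. by move=> t; rewrite [RHS]tuple_eta; apply/val_inj. Qed.

Section Succ.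
Context {n : nat} (mu : {sigma_finite_measure set (n.-tuple T) -> \bar R}).

Definition lebesgue_tuple_succ : set (n.+1.-tuple T) -> \bar R :=
  pushforward (@lebesgue_measure R \x mu) (@tuple_cons n).

Let prod_mu : {measure set (T * n.-tuple T)%type -> \bar R} :=
  @lebesgue_measure R \x mu.

Let measurable_preimage_cons (A : set (n.+1.-tuple T)) :
  measurable A -> measurable (@tuple_cons n @^-1` A).
Proof.
by move=> mA; rewrite -[X in measurable X]setTI; exact: measurable_tuple_cons.
Qed.

Let succ0 : lebesgue_tuple_succ set0 = 0.
Proof. by rewrite /lebesgue_tuple_succ /pushforward preimage_set0 measure0. Qed.

Let succ_ge0 A : 0 <= lebesgue_tuple_succ A.
Proof. exact: (measure_ge0 prod_mu). Qed.

Let succ_sigma_additive : semi_sigma_additive lebesgue_tuple_succ.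
Proof.
move=> F mF tF mUF; rewrite /lebesgue_tuple_succ /pushforward preimage_bigcup.
apply: (@measure_semi_sigma_additive _ _ _ prod_mu).
- by move=> k; exact: measurable_preimage_cons.
- apply/trivIsetP => /= i j _ _ ij; rewrite -preimage_setI.
  by move/trivIsetP : tF => /(_ _ _ _ _ ij) ->//; rewrite preimage_set0.
- by rewrite -preimage_bigcup; exact: measurable_preimage_cons.
Qed.

HB.instance Definition _ := isMeasure.Build _ _ _ lebesgue_tuple_succ
  succ0 succ_ge0 succ_sigma_additive.

Let succ_sigma_finite : sigma_finite setT lebesgue_tuple_succ.
Proof.
have /sigma_finiteP[F [TF ndF Foo]] := sigma_finiteT (@lebesgue_measure R).
have /sigma_finiteP[G [TG ndG Goo]] := sigma_finiteT mu.
exists (fun k => @tuple_uncons n @^-1` (F k `*` G k)).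
  rewrite -preimage_bigcup (_ : \bigcup_k _ = setT) ?preimage_setT//.
  apply/seteqP; split=> // -[x y] _.
  have [i _ Fix] : (\bigcup_k F k) x by rewrite -TF.
  have [j _ Gjy] : (\bigcup_k G k) y by rewrite -TG.
  exists (maxn i j) => //; split => /=.
    by move: x Fix; exact/subsetPset/ndF/leq_maxl.
  by move: y Gjy; exact/subsetPset/ndG/leq_maxr.
move=> k; have [mFk Fk] := Foo k; have [mGk Gk] := Goo k; split.
  rewrite -[X in measurable X]setTI; apply: measurable_tuple_uncons => //.
  exact: measurableX.
rewrite /lebesgue_tuple_succ /pushforward -comp_preimage.
rewrite (_ : _ \o _ = id) ?preimage_id; last exact/funext/tuple_consK.
by rewrite product_measure1E// lte_mul_pinfty// ge0_fin_numE.
Qed.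

HB.instance Definition _ := Measure_isSigmaFinite.Build _ _ _
  lebesgue_tuple_succ succ_sigma_finite.

End Succ.

Fixpoint lebesgue_measure_tuple n :
    {sigma_finite_measure set (n.-tuple T) -> \bar R} :=
  match n with
  | 0 => \d_([tuple] : 0.-tuple T)
  | n'.+1 => lebesgue_tuple_succ (lebesgue_measure_tuple n')
  end.

Lemma lebesgue_measure_tuple_box n (A : 'I_n -> set T) :
  (forall i, measurable (A i)) ->
  lebesgue_measure_tuple n [set t | forall i, A i (tnth t i)] =
  \prod_(i < n) lebesgue_measure (A i).
Proof.
elim: n A => [|n IH] A mA.
  by rewrite big_ord0 /= diracE mem_set// => -[].
rewrite big_ord_recl -IH//= /lebesgue_tuple_succ /pushforward.
rewrite -product_measure1E//; last first.
  rewrite (_ : [set t | _] = \bigcap_(i : 'I_n)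
      ((@tnth n T ^~ i) @^-1` A (lift ord0 i))); last first.
    by apply/seteqP; split => t /= + i; [move=> /(_ i)|move=> /(_ i I)].
  apply: fin_bigcap_measurable => [|i _]; first exact: finite_finset.
  by rewrite -[X in measurable X]setTI; exact: measurable_tnth.
congr (_ _); apply/seteqP; split => -[x t] /=.
  move=> At; split; first by have := At ord0; rewrite tnth0.
  by move=> i; have := At (lift ord0 i); rewrite tnthS.
move=> [Ax At] i; case: (unliftP ord0 i) => [j|] ->; last by rewrite tnth0.
by rewrite tnthS.
Qed.

End LebesgueMeasureTuple.

Section EmpiricalCopula.
Context {R : realType} {n d : nat} (X : 'I_n -> d.-tuple R).

Definition ecdf (j : 'I_d) (x : R) : R :=
  n%:R^-1 * \sum_(i < n) (tnth (X i) j <= x)%R%:R.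

Definition pseudo_obs (i : 'I_n) (j : 'I_d) : R := ecdf j (tnth (X i) j).

Definition empirical_copula (u : d.-tuple R) : R :=
  n%:R^-1 * \sum_(i < n) \prod_(j < d) (pseudo_obs i j <= tnth u j)%R%:R.

End EmpiricalCopula.

Definition unit_cube (R : realType) (d : nat) :
    set (d.-tuple (measurableTypeR R)) :=
  [set u | forall j, `[0, 1]%classic (tnth u j)].
Arguments unit_cube : clear implicits.

(* Main.v *)
Require Import Defs.
From mathcomp Require Import all_boot all_order all_algebra.
From mathcomp Require Import all_classical all_reals all_analysis.
From mathcomp Require Import measurable_realfun.
From mathcomp Require Import ring.
Import Order.TTheory GRing.Theory Num.Theory.
Import numFieldNormedType.Exports.
Local Open Scope classical_set_scope.
Local Open Scope ring_scope.

(** The integrand is a sum of functions that factor over the coordinates, so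
    the integral over the cube is a sum of products of one-dimensional
    integrals.

    Write [U i j] for the pseudo-observations, [w x = (x - 1/2)^2], and [1_i]
    for the indicator of [U i j <= u_j for all j]. The empirical copula is the
    mean of the [1_i], hence expanding the square ([sqr_mean_sub]) gives
    [n^-2 sum_(i, l) 1_i 1_l W - 2 n^-1 sum_i 1_i Pi W + Pi^2 W],
    where [W] and [Pi] are the products over [j] of [w u_j] and [u_j]. Since
    [1_i 1_l] is the product over [j] of the indicators of
    [max (U i j) (U l j) <= u_j], each term is a product over [j] of a function
    of [u_j] alone. Fubini's theorem, iterated along the recursive construction
    of the Lebesgue measure on tuples ([integral_unit_cube_prod]), leaves three
    integrals over [[0, 1]]:
    - of [w] over [[a, 1]], with [a] a maximum of two pseudo-observations;
    - of [x w x] over [[a, 1]], with [a] a pseudo-observation;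
    - of [x^2 w x] over [[0, 1]], which is 1/30.
    They follow from the fundamental theorem of calculus applied to polynomials
    ([integral_tail_horner_deriv]); this is where pseudo-observations have to
    lie in [[0, 1]] ([pseudo_obs_itv]). *)

(** * Integrals of products of functions of separate variables *)

Section TensorProduct.
Context {d1 d2} {T1 : measurableType d1} {T2 : measurableType d2}
  {R : realType}.
Variables (m1 : {sigma_finite_measure set T1 -> \bar R})
  (m2 : {sigma_finite_measure set T2 -> \bar R}).
Variables (f : T1 -> R) (g : T2 -> R).
Hypotheses (fi : m1.-integrable setT (EFin \o f))
  (gi : m2.-integrable setT (EFin \o g)).

(** By Tonelli it is enough that the iterated integral of the absolute value is
    finite, and that one factors into the two finite integrals of [|f|] and
    [|g|]. *)
Lemma integrable_tensor :
  (m1 \x m2)%E.-integrable setT (fun z => (f z.1 * g z.2)%:E).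
Proof.
have /measurable_EFinP mf := measurable_int _ fi.
have /measurable_EFinP mg := measurable_int _ gi.
apply/integrable12ltyP.
  apply/measurable_EFinP/measurable_funM.
    exact: measurableT_comp mf measurable_fst.
  exact: measurableT_comp mg measurable_snd.
under eq_integral => x _.
  under eq_integral do rewrite /= normrM EFinM.
  rewrite (integralZl measurableT (integrable_norm gi)) muleC.
  over.
have gfin := integrable_fin_num measurableT (integrable_norm gi).
rewrite -(fineK gfin) (integralZl measurableT (integrable_norm fi)) ltey_eq.
by rewrite fin_numM// (integrable_fin_num measurableT (integrable_norm fi)).
Qed.

Lemma integral_tensor :
  (\int[m1 \x m2]_z (f z.1 * g z.2)%:E =
   (\int[m1]_x (f x)%:E) * (\int[m2]_y (g y)%:E))%E.
Proof.
rewrite -integral12_prod_meas1 /fubini_F; last exact: integrable_tensor.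
under eq_integral => x _.
  under eq_integral do rewrite /= EFinM.
  rewrite (integralZl measurableT gi) muleC.
  over.
have gfin := integrable_fin_num measurableT gi.
by rewrite -(fineK gfin) (integralZl measurableT fi) muleC.
Qed.

End TensorProduct.

Section TupleIntegral.
Context {R : realType}.
Local Notation mu := (@lebesgue_measure R).
Local Notation T := (measurableTypeR R).

(** By induction on the dimension: the measure on [n.+1]-tuples is the image of
    the product of the line with the measure on [n]-tuples, so transferring the
    integral to that product separates the head coordinate from the others.
    Integrability is part of the statement because the induction step applies
    Fubini to the product over the tail. *)
Lemma integral_tuple_prod n (f : 'I_n -> T -> R) :
  (forall j, mu.-integrable setT (EFin \o f j)) ->
  (lebesgue_measure_tuple n).-integrable setT
    (fun t => (\prod_(j < n) f j (tnth t j))%:E) /\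
  (\int[lebesgue_measure_tuple n]_t (\prod_(j < n) f j (tnth t j)) =
   \prod_(j < n) \int[mu]_x f j x).
Proof.
elim: n f => [|n IH] f fi.
  split.
    by under eq_fun do rewrite big_ord0; exact: finite_measure_integrable_cst.
  rewrite big_ord0 /Rintegral; under eq_integral do rewrite big_ord0.
  rewrite integral_cst// mul1e -[RHS]/(fine 1%E); congr fine; exact: diracT.
have [gi ge] := IH (fun j => f (lift ord0 j)) (fun j => fi (lift ord0 j)).
set g := fun t : n.-tuple T => \prod_(j < n) f (lift ord0 j) (tnth t j).
have consE : (fun t : n.+1.-tuple T => (\prod_(j < n.+1) f j (tnth t j))%:E) \o
    (@tuple_cons R n) = (fun z => (f ord0 z.1 * g z.2)%:E).
  apply/funext => -[x t] /=; rewrite big_ord_recl tnth0.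
  by under eq_bigr do rewrite tnthS.
have mprod : measurable_fun setT
    (fun t : n.+1.-tuple T => (\prod_(j < n.+1) f j (tnth t j))%:E).
  apply/measurable_EFinP; apply: measurable_prod => j _.
  have /measurable_EFinP mf := measurable_int _ (fi j).
  exact: measurableT_comp mf (measurable_tnth _).
have iprod := integrable_tensor mu (lebesgue_measure_tuple n) _ _ (fi ord0) gi.
split.
  apply: (integrable_pushforward (@measurable_tuple_cons R n)) => //.
  by rewrite consE.
rewrite /Rintegral.
rewrite [X in fine X](integral_pushforward (@measurable_tuple_cons R n) mprod).
- rewrite consE preimage_setT integral_tensor// big_ord_recl -ge fineM//.
    exact: (integrable_fin_num measurableT (fi ord0)).
  exact: (integrable_fin_num measurableT gi).
- by rewrite consE.
- by [].
Qed.

Lemma measurable_unit_cube d : measurable (unit_cube R d).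
Proof.
rewrite (_ : unit_cube R d = \bigcap_(j : 'I_d)
    ((@tnth d T ^~ j) @^-1` `[0, 1]%classic)); last first.
  by apply/seteqP; split => t /= + j; [move=> /(_ j)|move=> /(_ j I)].
apply: fin_bigcap_measurable => [|j _]; first exact: finite_finset.
by rewrite -[X in measurable X]setTI; exact: measurable_tnth.
Qed.

(** The restriction of a product to a cube is the product of the restrictions
    of its factors, which reduces this to the whole space. *)
Lemma integral_unit_cube_prod d (f : 'I_d -> T -> R) :
  (forall j, mu.-integrable `[0, 1] (EFin \o f j)) ->
  (lebesgue_measure_tuple d).-integrable (unit_cube R d)
    (fun u => (\prod_(j < d) f j (tnth u j))%:E) /\
  (\int[lebesgue_measure_tuple d]_(u in unit_cube R d)
     (\prod_(j < d) f j (tnth u j)) =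
   \prod_(j < d) \int[mu]_(x in `[0, 1]) f j x).
Proof.
move=> fi.
have fi' j : mu.-integrable setT (EFin \o (f j \_ `[0, 1])).
  rewrite -restrict_EFin.
  by apply: (iffLR (integrable_mkcond (EFin \o f j) _)).
have restrE : (fun u : d.-tuple T => \prod_(j < d) (f j \_ `[0, 1]) (tnth u j)) =
    (fun u : d.-tuple T => \prod_(j < d) f j (tnth u j)) \_ (unit_cube R d).
  apply/funext => u; rewrite patchE; case: ifPn => [/set_mem uI|].
    by apply: eq_bigr => j _; rewrite patchE mem_set//; exact: uI.
  move/negP => uI; have [j ujI] : exists j, ~ (`[0, 1]%classic (tnth u j)).
    by apply/existsNP => uI'; apply: uI; exact: mem_set.
  rewrite (bigD1 j)//= patchE ifN ?mul0r//; apply/negP => /set_mem.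
  exact: ujI.
have [gi ge] := integral_tuple_prod _ _ fi'; split.
  apply/(integrable_mkcond _ (measurable_unit_cube d)).
  by rewrite -[X in X \_ _]/(EFin \o _) restrict_EFin -restrE.
rewrite Rintegral_mkcond -restrE ge; apply: eq_bigr => j _.
by rewrite -Rintegral_mkcond.
Qed.

End TupleIntegral.

(** * Linearity over finite sums *)

Section FiniteSums.
Context {d} {T : measurableType d} {R : realType}.
Variables (mu : {measure set T -> \bar R}) (D : set T) (mD : measurable D).
Variables (I : Type) (s : seq I) (h : I -> T -> R).
Hypothesis hi : forall i, mu.-integrable D (EFin \o h i).

Lemma integrable_sum_EFin :
  mu.-integrable D (EFin \o (fun x => \sum_(i <- s) h i x)).
Proof.
rewrite (_ : EFin \o _ = (fun x => \sum_(i <- s) (h i x)%:E)%E); last first.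
  by apply/funext => x; rewrite /= sumEFin.
by apply: integrable_sum => // i _; exact: hi.
Qed.

Lemma Rintegral_sum :
  \int[mu]_(x in D) (\sum_(i <- s) h i x) =
  \sum_(i <- s) \int[mu]_(x in D) h i x.
Proof.
rewrite /Rintegral sum_fine => [|i _]; last exact: (integrable_fin_num mD (hi i)).
rewrite -integral_sum//; congr fine.
by apply: eq_integral => x _; rewrite sumEFin.
Qed.

End FiniteSums.

(** * One-dimensional integrals *)

Section Moments.
Context {R : realType}.
Local Notation mu := (@lebesgue_measure R).
Local Notation T := (measurableTypeR R).

(** The factor [a <= x] cuts the integral down to [[a, 1]], where the
    polynomial [p] is an antiderivative. For [a < 0] or [a > 1] the right-hand
    side would be the integral over an oriented segment leaving [[0, 1]]. *)
Lemma integral_tail_horner_deriv (p : {poly R}) (a : R) : 0 <= a <= 1 ->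
  mu.-integrable `[0, 1] (EFin \o (fun x => (a <= x)%R%:R * p^`().[x])) /\
  \int[mu]_(x in `[0, 1]) ((a <= x)%R%:R * p^`().[x]) = p.[1] - p.[a].
Proof.
move=> /andP[a0 a1].
have cq (A : set R) : {within A, continuous (horner p^`())}.
  by apply: continuous_subspaceT => x; exact: continuous_horner.
have aI : `[0, 1] `&` `[a, 1] = `[a, 1]%classic :> set R.
  apply/seteqP; split=> [x []//|x /=]; rewrite !in_itv/= => /andP[ax ->].
  by rewrite ax (le_trans a0 ax).
have tailE : {in `[0, 1]%classic, (horner p^`() \_ `[a, 1]) =1
    (fun x => (a <= x)%R%:R * p^`().[x])}.
  move=> x /set_mem /=; rewrite in_itv/= => /andP[_ x1].
  rewrite patchE; have [ax|ax] := boolP (a <= x)%R.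
    by rewrite mem_set ?mul1r//= in_itv/= ax.
  rewrite mul0r ifN//; apply/negP => /set_mem/=.
  by rewrite in_itv/= (negbTE ax).
split.
  apply: (eq_integrable (T := T) (measurable_itv _)
    (EFin \o (horner p^`() \_ `[a, 1]))).
    by move=> x xI; rewrite /= tailE.
  rewrite -restrict_EFin; apply/integrable_restrict => //.
  rewrite aI; apply: continuous_compact_integrable => //.
  exact: segment_compact.
rewrite -(eq_Rintegral mu tailE) -Rintegral_mkcondr aI.
(* for [a = 1] the interval is a point, a case apart from the fundamental
   theorem of calculus *)
move: a1; rewrite le_eqVlt => /predU1P[->|a1].
  by rewrite set_itv1 Rintegral_set1 subrr.
rewrite /Rintegral (continuous_FTC2 a1 (cq _) (F := horner p))//.
- split; first by move=> x _; exact: derivable_horner.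
    by apply: cvg_at_right_filter; exact: continuous_horner.
  by apply: cvg_at_left_filter; exact: continuous_horner.
- by move=> x _; rewrite derivE.
Qed.

Lemma integral_tail_weight (a : R) : 0 <= a <= 1 ->
  mu.-integrable `[0, 1] (EFin \o (fun x => (a <= x)%R%:R * (x - 2^-1) ^+ 2)) /\
  \int[mu]_(x in `[0, 1]) ((a <= x)%R%:R * (x - 2^-1) ^+ 2) =
  24^-1 - 3^-1 * (a - 2^-1) ^+ 3.
Proof.
move=> /(integral_tail_horner_deriv (3^-1 *: ('X - (2^-1)%:P) ^+ 3)).
have -> : (fun x : R => (a <= x)%R%:R *
      (3^-1 *: ('X - (2^-1)%:P) ^+ 3 : {poly R})^`().[x]) =
    (fun x => (a <= x)%R%:R * (x - 2^-1) ^+ 2).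
  by apply/funext => x; rewrite !(poly.derivCE, hornerE)/=; field.
by rewrite !hornerE /= => -[? ->]; split=> //; field.
Qed.

Lemma integral_tail_id_weight (a : R) : 0 <= a <= 1 ->
  mu.-integrable `[0, 1]
    (EFin \o (fun x => (a <= x)%R%:R * (x * (x - 2^-1) ^+ 2))) /\
  \int[mu]_(x in `[0, 1]) ((a <= x)%R%:R * (x * (x - 2^-1) ^+ 2)) =
  24^-1 - 4^-1 * a ^+ 4 + 3^-1 * a ^+ 3 - 8^-1 * a ^+ 2.
Proof.
(* an antiderivative of [x^3 - x^2 + x/4] *)
move=> /(integral_tail_horner_deriv
  (4^-1 *: 'X^4 - 3^-1 *: 'X^3 + 8^-1 *: 'X^2)).
have -> : (fun x : R => (a <= x)%R%:R *
      (4^-1 *: 'X^4 - 3^-1 *: 'X^3 + 8^-1 *: 'X^2 : {poly R})^`().[x]) =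
    (fun x => (a <= x)%R%:R * (x * (x - 2^-1) ^+ 2)).
  by apply/funext => x; rewrite !(poly.derivCE, hornerE)/=; field.
by rewrite !hornerE /= => -[? ->]; split=> //; field.
Qed.

Lemma integral_sqr_weight :
  mu.-integrable `[0, 1] (EFin \o (fun x : R => x ^+ 2 * (x - 2^-1) ^+ 2)) /\
  \int[mu]_(x in `[0, 1]) (x ^+ 2 * (x - 2^-1) ^+ 2) = 30^-1 :> R.
Proof.
(* an antiderivative of [x^4 - x^3 + x^2/4]; taking [a := 0] in the tail
   formula makes its indicator constant on [[0, 1]] *)
pose p : {poly R} := 5^-1 *: 'X^5 - 4^-1 *: 'X^4 + 12^-1 *: 'X^3.
have pE : {in `[0, 1]%classic, (fun x : R => (0 <= x)%R%:R * p^`().[x]) =1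
    (fun x => x ^+ 2 * (x - 2^-1) ^+ 2)}.
  move=> x /set_mem /=; rewrite in_itv/= => /andP[-> _].
  by rewrite mul1r !(poly.derivCE, hornerE)/=; field.
have [|pi pI] := integral_tail_horner_deriv p 0; first by rewrite lexx ler01.
split.
  apply: (eq_integrable (T := T) (measurable_itv _) _ _ _ pi).
  by move=> x xI; rewrite /= pE.
by rewrite -(eq_Rintegral mu pE) pI !hornerE /=; field.
Qed.

End Moments.

(** * The statistic *)

Lemma pseudo_obs_itv (R : realType) (n d : nat) (X : 'I_n -> d.-tuple R) i j :
  0 <= pseudo_obs X i j <= 1.
Proof.
rewrite /pseudo_obs /ecdf mulr_ge0 ?invr_ge0 ?sumr_ge0//=.
have n0 : (0 < n)%N by case: n i {X} => [[]|].
rewrite ler_pdivrMl ?ltr0n// mulr1 -[leRHS]mulr1 -[n in n%:R]card_ord.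
rewrite mulr_natl -sumr_const ler_sum// => l _.
by rewrite lern1 leq_b1.
Qed.

(** The weight [w] is kept inside every term of the expansion so that, when
    [S i], [p] and [w] are products over the coordinates, each term merges into
    a single such product. *)
Lemma sqr_mean_sub (R : comPzRingType) n (c : R) (S : 'I_n -> R) (p w : R) :
  (c * \sum_(i < n) S i - p) ^+ 2 * w =
  c ^+ 2 * \sum_(il : 'I_n * 'I_n) (S il.1 * S il.2 * w) -
  2 * c * \sum_(i < n) (S i * p * w) + p ^+ 2 * w.
Proof.
rewrite -(pair_bigA _ (fun i l => S i * S l * w)) /=.
under [in RHS]eq_bigr do
  (under eq_bigr do rewrite -mulrA; rewrite -mulr_sumr -mulr_suml).
under [\sum_(i < n) (_ * p * _)]eq_bigr do rewrite -mulrA.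
rewrite -!mulr_suml; ring.
Qed.

Theorem proposition5 (R : realType) (d n : nat) (hd : (2 <= d)%N)
    (hn : (1 <= n)%N) (X : 'I_n -> d.-tuple R) :
  n%:R * \int[lebesgue_measure_tuple d]_(u in unit_cube R d)
    ((empirical_copula X u - \prod_(j < d) tnth u j) ^+ 2 *
     \prod_(j < d) (tnth u j - 2^-1) ^+ 2) =
  \sum_(i < n)
    (n%:R^-1 * \sum_(l < n) \prod_(j < d)
       (24^-1 - 3^-1 *
         (Num.max (pseudo_obs X i j) (pseudo_obs X l j) - 2^-1) ^+ 3) -
     2 * \prod_(j < d)
       (24^-1 - 4^-1 * pseudo_obs X i j ^+ 4 + 3^-1 * pseudo_obs X i j ^+ 3
        - 8^-1 * pseudo_obs X i j ^+ 2)) +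
  n%:R * 30 ^- d.
Proof.
set U := pseudo_obs X.
have U01 i j : 0 <= U i j <= 1 by exact: pseudo_obs_itv.
have M01 i l j : 0 <= Num.max (U i j) (U l j) <= 1.
  have /andP[? ?] := U01 i j; have /andP[? ?] := U01 l j.
  by rewrite le_max ge_max; apply/andP; split; [apply/orP; left|apply/andP].
(* [A], [B], [C] are the terms of the expanded square, with the indicators of
   two observations merged through the maximum of their thresholds. *)
pose A (il : 'I_n * 'I_n) (u : d.-tuple (measurableTypeR R)) : R :=
  \prod_(j < d) ((Num.max (U il.1 j) (U il.2 j) <= tnth u j)%R%:R *
    (tnth u j - 2^-1) ^+ 2).
pose B i (u : d.-tuple (measurableTypeR R)) : R := \prod_(j < d)
  ((U i j <= tnth u j)%R%:R * (tnth u j * (tnth u j - 2^-1) ^+ 2)).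
pose C (u : d.-tuple (measurableTypeR R)) : R := \prod_(j < d)
  (tnth u j ^+ 2 * (tnth u j - 2^-1) ^+ 2).
have [iA IA] : (forall il, (lebesgue_measure_tuple d).-integrable
      (unit_cube R d) (EFin \o A il)) /\
    (forall il, \int[lebesgue_measure_tuple d]_(u in unit_cube R d) A il u =
      \prod_(j < d) (24^-1 - 3^-1 *
        (Num.max (U il.1 j) (U il.2 j) - 2^-1) ^+ 3)).
  split=> il; have [ic e] := integral_unit_cube_prod d _
      (fun j => (integral_tail_weight _ (M01 il.1 il.2 j)).1) => //.
  by rewrite e; apply: eq_bigr => j _; rewrite (integral_tail_weight _ _).2.
have [iB IB] : (forall i, (lebesgue_measure_tuple d).-integrable
      (unit_cube R d) (EFin \o B i)) /\
    (forall i, \int[lebesgue_measure_tuple d]_(u in unit_cube R d) B i u =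
      \prod_(j < d) (24^-1 - 4^-1 * U i j ^+ 4 + 3^-1 * U i j ^+ 3
        - 8^-1 * U i j ^+ 2)).
  split=> i; have [ic e] := integral_unit_cube_prod d _
      (fun j => (integral_tail_id_weight _ (U01 i j)).1) => //.
  by rewrite e; apply: eq_bigr => j _; rewrite (integral_tail_id_weight _ _).2.
have [iC IC] : (lebesgue_measure_tuple d).-integrable
      (unit_cube R d) (EFin \o C) /\
    \int[lebesgue_measure_tuple d]_(u in unit_cube R d) C u = 30 ^- d.
  have [ic e] := integral_unit_cube_prod d
    (fun _ x => x ^+ 2 * (x - 2^-1) ^+ 2)
    (fun=> (@integral_sqr_weight R).1).
  split=> //; rewrite e; under eq_bigr do rewrite integral_sqr_weight.2.
  by rewrite prodr_const card_ord exprVn.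
have mI := @measurable_unit_cube R d.
have integrandE : {in unit_cube R d, (fun u =>
    ((empirical_copula X u - \prod_(j < d) tnth u j) ^+ 2 *
     \prod_(j < d) (tnth u j - 2^-1) ^+ 2)) =1
  (fun u => n%:R^-1 ^+ 2 * (\sum_il A il u) -
     2 * n%:R^-1 * (\sum_i B i u) + C u)}.
  move=> u _; rewrite /empirical_copula sqr_mean_sub; congr (_ * _ - _ * _ + _).
  - apply: eq_bigr => -[i l] _; rewrite /A -!big_split/=; apply: eq_bigr => j _.
    by rewrite ge_max -mulnb natrM.
  - apply: eq_bigr => i _; rewrite /B -!big_split/=; apply: eq_bigr => j _.
    by rewrite mulrA.
  - by rewrite /C -prodrXl -big_split.
have iSA := integrable_sum_EFin _ _ mI _ (index_enum _) _ iA.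
have iSB := integrable_sum_EFin _ _ mI _ (index_enum _) _ iB.
have iZA := integrableZl mI (n%:R^-1 ^+ 2) iSA.
have iZB := integrableZl mI (2 * n%:R^-1) iSB.
rewrite (eq_Rintegral (lebesgue_measure_tuple d) integrandE).
rewrite RintegralD//; last exact: (integrableB mI iZA iZB).
rewrite RintegralB// !RintegralZl// !Rintegral_sum// IC.
under eq_bigr do rewrite IA.
under [\sum_(i < n) Rintegral _ _ _]eq_bigr do rewrite IB.
rewrite -(pair_bigA _ (fun i l => \prod_(j < d)
  (24^-1 - 3^-1 * (Num.max (U i j) (U l j) - 2^-1) ^+ 3))) /=.
rewrite sumrB -!mulr_sumr; field.
by rewrite expf_neq0 ?pnatr_eq0 -?lt0n.
Qed.
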